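(* Let $m\ge 1$ and $0\le r\le m$ be integers. The treewidth $\kappa(r,m)$ and the trelliswidth $\tau(r,m)$ of the binary Reed-Muller code $\mathrm{RM}(r,m)$ satisfy $$\kappa(r,m)=\tau(r,m)=\begin{cases}\displaystyle\sum_{j=0}^{r}\binom{m-2j-1}{r-j} & \text{if } m\ge 2r+1,\\[2mm] 1+\displaystyle\sum_{j=0}^{m-r-1}\binom{m-2j-1}{r-j} & \text{if } m<2r+1.\end{cases}$$
   Context: For integers $m\ge1$ and $0\le r\le m$, $\mathrm{RM}(r,m)$ is the binary linear code of length $n=2^m$ with index set $I=[0,2^m-1]$ consisting of all vectors $(f(\mathbf{b}(0)),f(\mathbf{b}(1)),\dots,f(\mathbf{b}(2^m-1)))$, where $f$ ranges over Boolean polynomials in $m$ variables of degree at most $r$, and $\mathbf{b}(i)=(b_0(i),\dots,b_{m-1}(i))\in\{0,1\}^m$ is given by the binary expansion $i=\sum_{j=0}^{m-1}b_j(i)2^j$. Let $\mathcal{C}$ be a linear code of dimension $k$ and length $n$ with index set $I$. For $J\subseteq I$, the shortening $\mathcal{C}_J$ is the code obtained by restricting to the coordinates in $J$ those codewords $c\in\mathcal{C}$ with $c_i=0$ for all $i\notin J$ (so $\mathcal{C}_\emptyset$ has dimension $0$). A tree is a connected graph with no cycles. A tree decomposition of $\mathcal{C}$ is a pair $(T,\omega)$ where $T$ is a (finite) tree and $\omega: I\to V(T)$ is any map. For a node $v$ of $T$, let $E(v)$ be the set of edges incident with $v$; for $e\in E(v)$ let $T_{e,v}$ be the component of $T-e$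 not containing $v$, and let $I_{e,v}=\omega^{-1}(V(T_{e,v}))$. Put $$\kappa_v = k-\sum_{e\in E(v)}\dim(\mathcal{C}_{I_{e,v}}),\qquad \kappa(\mathcal{C};T,\omega)=\max_{v\in V(T)}\kappa_v .$$ The treewidth of $\mathcal{C}$ is $\kappa(\mathcal{C})=\min_{(T,\omega)}\kappa(\mathcal{C};T,\omega)$, the minimum being over all tree decompositions of $\mathcal{C}$. The trelliswidth of $\mathcal{C}$ is $\tau(\mathcal{C})=\min_{\pi}\kappa(\mathcal{C};P,\pi)$, where $P$ is the path on $n$ nodes and the minimum is over all bijections $\pi: I\to V(P)$. Write $\kappa(r,m)=\kappa(\mathrm{RM}(r,m))$ and $\tau(r,m)=\tau(\mathrm{RM}(r,m))$. *)

(* Defs.v *)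
From HB Require Import structures.
From mathcomp Require Import all_boot all_order all_algebra.
From mathcomp Require Import boolp.
From mathcomp Require Import mpoly.

Set Implicit Arguments.
Unset Strict Implicit.
Unset Printing Implicit Defensive.

Import GRing.Theory.

(* The space of words over F with index set I; linear codes are its subspaces.
   The regular module F^o is what makes it a vectType over F. *)
Notation word F I := {ffun I -> F^o}.

Section Shortening.
Variables (F : fieldType) (I : finType).

Definition restrict (J : {set I}) (c : word F I) : word F {i : I | i \in J} :=
  [ffun i => c (val i)].

Fact restrict_linear (J : {set I}) : linear (restrict J).
Proof. by move=> a c d; apply/ffunP=> i; rewrite !ffunE. Qed.

HB.instance Definition _ (J : {set I}) :=
  GRing.isLinear.Build F (word F I) (word F {i : I | i \in J}) *:%R
    (restrict J) (restrict_linear J).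

Definition shortening (C : {vspace word F I}) (J : {set I}) :
    {vspace word F {i : I | i \in J}} :=
  (linfun (restrict J) @: (C :&: lker (linfun (restrict (~: J)))))%VS.

End Shortening.

Section Trees.
Variable (V : finType).
Implicit Types (g : rel V) (e : {set V}) (v : V).

(* The cycles (x, y) of length 2 traverse a single edge back and forth. *)
Definition acyclic g : Prop := forall c : seq V, ucycle g c -> size c <= 2.

Definition is_tree g : Prop :=
  [/\ ssrbool.symmetric g, irreflexive g, 0 < #|V|,
      (forall x y : V, connect g x y) & acyclic g].

Definition edges g : {set {set V}} :=
  [set [set p.1; p.2] | p : V * V & g p.1 p.2].

Definition incident_edges g v : {set {set V}} := [set e in edges g | v \in e].

Definition delete_edge g e : rel V :=
  [rel x y | g x y && ([set x; y] != e)].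

(* For an edge e of a tree, deleting e leaves two components, so these nodes
   form the component that does not contain v. *)
Definition far_component g e v : {set V} :=
  [set x | ~~ connect (delete_edge g e) v x].

End Trees.

Section Width.
Variables (F : fieldType) (I : finType) (C : {vspace word F I}).

(* The truncated subtraction is exact whenever g is connected, see
   leq_sum_dim_shortening below. *)
Definition node_width (V : finType) (g : rel V) (w : I -> V) (v : V) : nat :=
  \dim C - \sum_(e in incident_edges g v)
             \dim (shortening C (w @^-1: far_component g e v)).

Definition decomposition_width (V : finType) (g : rel V) (w : I -> V) : nat :=
  \max_(v : V) node_width g w v.

Definition attained_by_tree (k : nat) : Prop :=
  exists (V : finType) (g : rel V) (w : I -> V),
    is_tree g /\ decomposition_width g w = k.

Definition path_rel (n : nat) : rel 'I_n :=
  [rel i j : 'I_n | (i.+1 == j :> nat) || (j.+1 == i :> nat)].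

Definition attained_by_path (k : nat) : Prop :=
  exists w : I -> 'I_#|I|,
    bijective w /\ decomposition_width (@path_rel #|I|) w = k.

Fact ex_attained_by_tree : exists k, `[< attained_by_tree k >].
Proof.
pose w (_ : I) := tt.
pose g0 : rel unit := fun _ _ => false.
exists (decomposition_width g0 w); apply/asboolP.
exists unit, g0, w; split=> //; split=> //.
- by rewrite card_unit.
- by move=> [] [].
- by move=> [|[] [|? ?]] //; rewrite /ucycle /= andbF.
Qed.

Fact ex_attained_by_path : exists k, `[< attained_by_path k >].
Proof.
exists (decomposition_width (@path_rel #|I|) enum_rank); apply/asboolP.
by exists enum_rank; split=> //; exact: enum_rank_bij.
Qed.

Definition treewidth : nat := ex_minn ex_attained_by_tree.

Definition trelliswidth : nat := ex_minn ex_attained_by_path.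

End Width.

Section ReedMuller.
Local Open Scope ring_scope.

Definition bit (i j : nat) : 'F_2 := (odd (i %/ 2 ^ j))%:R.

Definition evaluation_word (m : nat) (f : {mpoly 'F_2[m]}) :
    word 'F_2 'I_(2 ^ m) :=
  [ffun i : 'I_(2 ^ m) => f.@[fun j : 'I_m => bit i j]].

(* msize is one more than the total degree (and 0 for the zero polynomial). *)
Definition is_RM_word (r m : nat) (c : word 'F_2 'I_(2 ^ m)) : Prop :=
  exists2 f : {mpoly 'F_2[m]}, (msize f <= r.+1)%N & c = evaluation_word f.

(* These words are closed under linear combinations, so that taking the span
   adds nothing, see mem_RM below. *)
Definition RM (r m : nat) : {vspace word 'F_2 'I_(2 ^ m)} :=
  <<enum [pred c | `[< is_RM_word r c >]]>>%VS.

Lemma mem_RM (r m : nat) (c : word 'F_2 'I_(2 ^ m)) :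
  (c \in RM r m) <-> is_RM_word r c.
Proof.
split; last first.
  by move=> cP; apply: memv_span; rewrite mem_enum inE; apply/asboolP.
move=> /coord_span ->.
apply: big_ind => [||i _].
- exists 0; first by rewrite mmeasure0.
  by apply/ffunP=> i; rewrite !ffunE meval0.
- move=> _ _ [f szf ->] [g szg ->]; exists (f + g).
    by rewrite (leq_trans (msizeD_le _ _)) // geq_max szf.
  by apply/ffunP=> i; rewrite !ffunE mevalD.
set s := enum_tuple _; set a := coord _ _ _.
have /asboolP [f szf ->] : `[< is_RM_word r s`_i >].
  have : s`_i \in s by apply: mem_nth; rewrite size_tuple.
  by rewrite mem_enum inE.
exists (a *: f); first by rewrite (leq_trans (msizeZ_le _ _)).
by apply/ffunP=> j; rewrite !ffunE mevalZ.
Qed.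

End ReedMuller.

Section TreeFacts.

Lemma path_rel_tree (n : nat) : 0 < n -> is_tree (@path_rel n).
Proof.
move=> n_gt0; have path_sym : ssrbool.symmetric (@path_rel n).
  by move=> i j; rewrite /path_rel /= orbC.
split=> //; first by move=> i; rewrite /path_rel /= orbb eqn_leq ltnn.
- by rewrite card_ord.
- have from0 (y : 'I_n) : connect (@path_rel n) (Ordinal n_gt0) y.
    case: y; elim=> [|k IHk] lt_k.
      by rewrite (_ : Ordinal lt_k = Ordinal n_gt0) //; exact: val_inj.
    apply: connect_trans (IHk (ltnW lt_k)) _; apply: connect1.
    by rewrite /path_rel /= eqxx.
  move=> x y; apply: connect_trans (from0 y).
  by rewrite (sym_connect_sym path_sym).
move=> c /andP [cycle_c uniq_c]; rewrite leqNgt; apply/negP => size_c.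
have [x0 x0c] : exists x0, x0 \in c.
  by case: c size_c {cycle_c uniq_c} => // x c _; exists x; rewrite mem_head.
have [x xc x_max] : exists2 x, x \in c & forall y : 'I_n, y \in c -> y <= x.
  by case: (arg_maxnP (fun i : 'I_n => val i) x0c) => x xc x_max; exists x.
have gn := next_cycle cycle_c xc; have gp := prev_cycle cycle_c xc.
have nc : next c x \in c by rewrite mem_next.
have pc : prev c x \in c by rewrite mem_prev.
have : next c x = prev c x.
  apply: val_inj; move: gn gp (x_max _ nc) (x_max _ pc); rewrite /path_rel /=.
  case/orP=> [/eqP <-|/eqP nx]; first by rewrite ltnn.
  case/orP=> [/eqP px|/eqP <-]; last by rewrite ltnn.
  by move=> _ _; apply: succn_inj; rewrite nx px.
have [i s rot_c] := rot_to xc.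
rewrite -(next_rot i uniq_c) -(prev_rot i uniq_c) rot_c.
move: uniq_c size_c; rewrite -(rot_uniq i) -(size_rot i) rot_c.
case: s {rot_c} => [|y [|z s]] //=.
rewrite eqxx; case/and4P=> xNyzs yNzs _ _ _.
move: xNyzs; rewrite !inE !negb_or => /and3P [/negPf -> /negPf -> xNs].
suff -> : prev_at x x z s = last z s.
  by move=> y_last; rewrite y_last mem_last in yNzs.
elim: s z xNs {yNzs} => [|t s IHs] z /=; first by rewrite eqxx.
by rewrite inE negb_or => /andP [/negPf -> /IHs ->].
Qed.

Lemma far_component_disjoint (V : finType) (g : rel V) (v x : V)
    (e e' : {set V}) :
  (forall y z, connect g y z) -> v \in e -> v \in e' ->
  x \in far_component g e v -> x \in far_component g e' v -> e = e'.
Proof.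
move=> /(_ v x) /connectP [p0 gp0 ->] ve ve'.
have [p gp + _] := shortenP gp0; case: p gp => [|u p] gp.
  by move=> _; rewrite inE connect0.
move=> uniq_p.
suff far_eq (f : {set V}) : v \in f -> last v (u :: p) \in far_component g f v ->
    [set v; u] = f by move=> /(far_eq _ ve) <- /(far_eq _ ve') <-.
move=> vf; rewrite inE => far; apply/eqP; apply: contraR far => neq_f.
apply/connectP; exists (u :: p) => //.
move: gp uniq_p; rewrite /delete_edge /= neq_f => /andP [-> gp] /andP [vNp _] /=.
have neq_v y z : y != v -> z != v -> [set y; z] != f.
  move=> yv zv; apply: contraNneq yv => E; move: vf.
  by rewrite -E !inE (eq_sym v z) (negPf zv) orbF eq_sym.
elim: p u gp vNp {neq_f} => //= y p IHp u /andP [-> gp].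
rewrite !inE !negb_or => /and3P [vu vy vp] /=.
by rewrite neq_v 1?eq_sym //= IHp // inE negb_or vy.
Qed.

Lemma leq_sum_dim_shortening (F : fieldType) (I : finType)
    (C : {vspace word F I}) (V : finType) (g : rel V) (w : I -> V) (v : V) :
  (forall x y, connect g x y) ->
  \sum_(e in incident_edges g v)
    \dim (shortening C (w @^-1: far_component g e v)) <= \dim C.
Proof.
move=> conn_g; pose J e := w @^-1: far_component g e v.
pose W e := (C :&: lker (linfun (@restrict F I (~: J e))))%VS.
have W_out e c i : c \in W e -> i \notin J e -> c i = 0%R.
  rewrite memv_cap memv_ker lfunE => /andP [_ /eqP /ffunP c0].
  by rewrite -in_setC => iJ; have := c0 (exist _ i iJ); rewrite !ffunE.
have dimW e : \dim (shortening C (J e)) <= \dim (W e).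
  by rewrite -(limg_ker_dim (linfun (@restrict F I (J e))) (W e)) leq_addl.
apply: leq_trans (leq_sum _ (fun e _ => dimW e)) _.
have dxW : directv (\sum_(e in incident_edges g v) W e).
  apply/directv_sum_independent => us usW us0 e ve; apply/ffunP=> i.
  rewrite ffunE; have [iJ|] := boolP (i \in J e); last exact: W_out (usW _ ve).
  have /ffunP/(_ i) := us0; rewrite ffunE sum_ffunE (bigD1 e) //=.
  rewrite big1 ?addr0 // => e' /andP [ve' neq].
  apply: W_out (usW _ ve') _; apply: contra neq => iJ'; apply/eqP.
  move: ve ve' iJ iJ'; rewrite !inE => /andP [_ ve] /andP [_ ve'] iJ iJ'.
  by apply: (far_component_disjoint conn_g ve' ve); rewrite inE; [exact: iJ' | exact: iJ].
rewrite -(directvP dxW); apply: dimvS; apply/subv_sumP => e _.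
exact: capvSl.
Qed.

End TreeFacts.

(* Main.v *)
From HB Require Import structures.
Require Import Defs.
From mathcomp Require Import all_boot all_order all_algebra.
From mathcomp Require Import boolp mpoly zify.

(* Put w = m - r, n = 2^m, and let G(s) = nheavy w s be the number of integers
   below s with at least w bits equal to 1.  By the (u | u + v) recursion, a
   subcode of RM(r, m) supported on s coordinates has dimension at most G(s), and the first
   or the last s coordinates attain this bound.  Hence the path in the standard
   order has width max_i (G(n) - G(i) - G(n - 1 - i)); the maximum is reached at
   t = floor(n / 3), whose bits are 0101..., and satisfies the recursion
   width(m, r) = C(m - 1, r) + width(m - 2, r - 1).
   Conversely, every tree decomposition has a node all of whose components have
   at most t coordinates, except possibly one with at most n - 1 - t
   coordinates.  As G is superadditive, the components can be merged until only
   a + b + c <= n is left, with a, b <= t < a + b, and then an induction on m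
   gives G(a) + G(b) + G(c) <= G(t) + G(n - 1 - t) if w > 0.  If w = 0, any node
   carrying a coordinate will do. *)

Set Implicit Arguments.
Unset Strict Implicit.
Unset Printing Implicit Defensive.

(** * Counting integers by their number of nonzero bits *)

(** The range [j < i] reaches every nonzero bit because [i < 2 ^ i]. *)
Definition popcount (i : nat) : nat := \sum_(j < i) odd (i %/ 2 ^ j).

Lemma popcountE (m i : nat) : i < 2 ^ m -> popcount i = \sum_(j < m) odd (i %/ 2 ^ j).
Proof.
have widen k l : k <= l -> i < 2 ^ k ->
    \sum_(j < k) odd (i %/ 2 ^ j) = \sum_(j < l) odd (i %/ 2 ^ j).
  move=> /subnKC <- ik; rewrite big_split_ord /= [X in _ + X]big1 ?addn0 // => j _.
  rewrite divn_small // (leq_trans ik) // leq_exp2l //; exact: leq_addr.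
move=> im; rewrite /popcount.
case: (leqP i m) => [le_im | /ltnW le_mi]; last by rewrite (widen m i).
by apply: widen => //; apply: ltn_expl.
Qed.

Lemma popcountD (b : bool) (i : nat) : popcount (b + i.*2) = b + popcount i.
Proof.
have lt_i : i < 2 ^ i by apply: ltn_expl.
rewrite (@popcountE i.+1) ?expnS; last by case: b; lia.
rewrite (@popcountE i i) // big_ord_recl /= divn1 oddD odd_double addbF oddb.
congr (_ + _); apply: eq_bigr => j _; rewrite expnS divnMA -[i.*2]muln2.
by rewrite addnC divnMDl // (@divn_small b 2) ?addn0; case: b.
Qed.

Lemma bit_top (m j i : nat) : i < 2 ^ m -> j < m ->
  odd ((2 ^ m + i) %/ 2 ^ j) = odd (i %/ 2 ^ j).
Proof.
move=> im jm; rewrite -{1}(subnKC jm) addSnnS expnD mulnC divnMDl ?expn_gt0 //.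
by rewrite oddD oddX.
Qed.

Lemma popcount_top (m i : nat) : i < 2 ^ m -> popcount (2 ^ m + i) = (popcount i).+1.
Proof.
move=> im; rewrite (@popcountE m.+1) ?expnS; last by lia.
rewrite (@popcountE m i) // big_ord_recr /= divnDl // divnn expn_gt0 divn_small //.
by rewrite addn1; congr _.+1; apply: eq_bigr => j _; rewrite bit_top.
Qed.

(** For [s = 2 ^ m] and [w <= m] this is the dimension of RM(m - w, m). *)
Definition nheavy (w s : nat) : nat := \sum_(i < s) (w <= popcount i).

Lemma nheavy0 w : nheavy w 0 = 0. Proof. by rewrite /nheavy big_ord0. Qed.

Lemma nheavyS w s : nheavy w s.+1 = nheavy w s + (w <= popcount s).
Proof. by rewrite /nheavy big_ord_recr. Qed.

Lemma nheavy0l s : nheavy 0 s = s.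
Proof. by rewrite /nheavy sum1_card card_ord. Qed.

Lemma leq_nheavy w s t : s <= t -> nheavy w s <= nheavy w t.
Proof.
move=> /subnKC <-; elim: (t - s) => [|d IHd]; first by rewrite addn0.
by rewrite addnS nheavyS (leq_trans IHd) // leq_addr.
Qed.

Lemma nheavyS_le w s : nheavy w s.+1 <= (nheavy w s).+1.
Proof. by rewrite nheavyS; case: leqP; lia. Qed.

Lemma nheavy_double w s : nheavy w s.*2 = nheavy w s + nheavy w.-1 s.
Proof.
elim: s => [|s IHs]; first by rewrite !nheavy0.
rewrite doubleS !nheavyS IHs (popcountD false s) (popcountD true s); lia.
Qed.

Lemma nheavy_doubleS w s : nheavy w s.*2.+1 = nheavy w s.+1 + nheavy w.-1 s.
Proof.
by rewrite !nheavyS nheavy_double (popcountD false s) add0n addnAC.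
Qed.

Lemma nheavy_top w m s : s <= 2 ^ m ->
  nheavy w (2 ^ m + s) = nheavy w (2 ^ m) + nheavy w.-1 s.
Proof.
elim: s => [|s IHs] sm; first by rewrite addn0 nheavy0 addn0.
rewrite addnS !nheavyS IHs ?(ltnW sm) // popcount_top // ; lia.
Qed.

(* Passing from [w] to [w + 1] drops the integers of weight [w], and these are
   more numerous below a larger bound. *)
Lemma nheavy_diff_mono w s t : s <= t ->
  nheavy w s + nheavy w.+1 t <= nheavy w t + nheavy w.+1 s.
Proof.
move=> /subnKC <-; elim: (t - s) => [|d IHd]; first by rewrite addn0 leqnn.
rewrite addnS !nheavyS; lia.
Qed.

Lemma nheavyW w s : nheavy w.+1 s <= nheavy w s.
Proof. by have := @nheavy_diff_mono w 0 s isT; rewrite !nheavy0; lia. Qed.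

Lemma nheavy_pred w s : nheavy w s <= nheavy w.-1 s.
Proof. by case: w => //= w; apply: nheavyW. Qed.

(** The numerical form of the (u | u + v) construction, with the smaller half at level [w.-1]. The
    proof halves [a] and [b]; when both are odd, [mono] moves the rounding from one level to the
    other. *)
Lemma nheavy_add w a b : a <= b -> nheavy w.-1 a + nheavy w b <= nheavy w (a + b).
Proof.
move: {2}(a + b) (leqnn (a + b)) => k; elim: k w a b => [|k IHk] w a b.
  by rewrite leqn0 addn_eq0 => /andP [/eqP -> /eqP ->]; rewrite !nheavy0.
have [-> _ _|a_gt0] := posnP a; first by rewrite nheavy0.
have mono u : nheavy w.-1 u.+1 + nheavy w.-2 u <= nheavy w.-1 u + nheavy w.-2 u.+1.
  case: w => [|[|w]] /=; first by rewrite addnC.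
    by rewrite addnC.
  by have := nheavy_diff_mono w (leqnSn u); lia.
rewrite -[a]odd_double_half -[b]odd_double_half.
move: (a./2) (b./2) (odd a) (odd b) (odd_double_half a) (odd_double_half b).
move=> u v [] [] /= au bv abk ab.
- have -> : true + u.*2 + (true + v.*2) = (u + v).+1.*2 by lia.
  rewrite !add1n !nheavy_doubleS nheavy_double.
  have [uv|uv] := eqVneq u v.
    have -> : (u + v).+1 = v.*2.+1 by lia.
    by rewrite uv !nheavy_doubleS; lia.
  have := IHk w u v.+1; have := IHk w.-1 u.+1 v; have := mono u.
  by rewrite addnS addSn; lia.
- have -> : true + u.*2 + (false + v.*2) = (u + v).*2.+1 by lia.
  rewrite !add1n add0n !nheavy_doubleS nheavy_double.
  by have := IHk w u.+1 v; have := IHk w.-1 u v; rewrite addSn; lia.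
- have -> : false + u.*2 + (true + v.*2) = (u + v).*2.+1 by lia.
  rewrite !add1n add0n !nheavy_doubleS nheavy_double.
  by have := IHk w u v.+1; have := IHk w.-1 u v; rewrite addnS; lia.
- have -> : false + u.*2 + (false + v.*2) = (u + v).*2 by lia.
  rewrite !add0n !nheavy_double.
  by have := IHk w u v; have := IHk w.-1 u v; lia.
Qed.

Lemma nheavy_superadd w a b : nheavy w a + nheavy w b <= nheavy w (a + b).
Proof.
wlog ab : a b / a <= b.
  by move=> wl; case: (leqP a b) => [|/ltnW] /wl; rewrite // addnC (addnC b).
by rewrite (leq_trans _ (nheavy_add w ab)) // leq_add2r nheavy_pred.
Qed.

Lemma popcount_gt0 i : 0 < i -> 0 < popcount i.
Proof.
elim/ltn_ind: i => i IHi i_gt0; rewrite -[i]odd_double_half popcountD.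
by case: (odd i) (odd_double_half i) => //= ei; apply: IHi; lia.
Qed.

(** Clearing bits of an integer of weight above [w] leads to a smaller one of weight exactly [w];
    the induction obtains this by halving [s]. *)
Lemma nheavy_ltW w s : 0 < nheavy w.+1 s -> nheavy w.+1 s < nheavy w s.
Proof.
elim/ltn_ind: s w => s IHs w; case: s IHs => [|[|s]] IHs; rewrite ?nheavy0 //.
  by rewrite nheavyS nheavy0 /popcount big_ord0.
have := odd_double_half s; move: (s./2) => k es.
have := nheavy_pred w k.+1; have := @leq_nheavy w _ _ (leqnSn k.+1).
have := IHs k.+2 _ w; have := IHs k.+1 _ w.
have -> : s.+2 = odd s + k.+1.*2 by lia.
case: (odd s) es => es; first by rewrite add1n !nheavy_doubleS /=; lia.
by rewrite add0n !nheavy_double /=; lia.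
Qed.

(* The smallest element of one of the two summands is light, which makes room
   for one element less in the superadditivity of [nheavy]. *)
Lemma nheavy_superaddS w a b :
  nheavy w.+1 a.+1 + nheavy w.+1 b.+1 <= nheavy w.+1 (a + b).+1.
Proof.
wlog ab : a b / a <= b.
  by move=> wl; case: (leqP a b) => [|/ltnW] /wl //; rewrite addnC (addnC b).
have [->|/nheavy_ltW lt_a] := posnP (nheavy w.+1 a.+1).
  by rewrite leq_nheavy // ltnS leq_addl.
have := @nheavy_add w.+1 a.+1 b.+1 ab; rewrite addSn addnS /=.
by have := nheavyS_le w.+1 (a + b).+1; lia.
Qed.

(** * Splitting the coordinates at a third *)

Definition third (m : nat) : nat := 2 ^ m %/ 3.

(** As 2 is -1 modulo 3, the residue of [2 ^ m] depends only on the parity of [m]. *)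
Lemma thirdE m : 2 ^ m = third m * 3 + (odd m).+1.
Proof.
rewrite {1}(divn_eq (2 ^ m) 3) -/(third m); congr (_ + _).
elim: m => //= m IHm; rewrite expnS -modnMmr IHm; by case: (odd m).
Qed.

Lemma third_lt m : third m < 2 ^ m.
Proof. by rewrite [X in _ < X]thirdE; lia. Qed.

Lemma thirdS m : third m.+1 = odd m + (third m).*2.
Proof.
have := thirdE m; have := thirdE m.+1; rewrite expnS /=.
by case: (odd m) => /=; lia.
Qed.

(** Induction on [m], halving all three parts. The term [w == 0] is there because [nheavy 0] is the
    identity: the left side is then [2 ^ m], while the first two terms on the right add up to
    [2 ^ m - 1]. *)
Lemma nheavy_three m w a b c :
  a <= third m -> b <= third m -> third m < a + b -> a + b + c = 2 ^ m ->
  nheavy w a + nheavy w b + nheavy w c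
    <= nheavy w (third m) + nheavy w (2 ^ m - (third m).+1) + (w == 0).
Proof.
elim: m w a b c => [|m IHm] w a b c; first by rewrite /third /=; lia.
rewrite thirdS; case: w => [|w].
  by rewrite !nheavy0l expnS; have := third_lt m; lia.
rewrite addn0; have lt3 := third_lt m.
have En := expnS 2 m; have E3 := thirdE m; have IH0 := IHm w; have IH1 := IHm w.+1.
move: (third m) (2 ^ m) (2 ^ m.+1) lt3 En E3 IH0 IH1 => t p n lt3 En E3 IH0 IH1.
have mono u : nheavy w.+1 u.+1 + nheavy w u <= nheavy w.+1 u + nheavy w u.+1.
  by have := nheavy_diff_mono w (leqnSn u); lia.
set k := p - t.+1 in IH0 IH1.
(* If two parts are odd, rounding up one of them at level [w.+1] and the other
   one at level [w] gives two triples of sum [p]; by [mono] this loses nothing. *)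
have halve : a <= t.*2 -> b <= t.*2 -> t.*2.+1 < a + b -> a + b + c = n ->
    nheavy w.+1 a + nheavy w.+1 b + nheavy w.+1 c
      <= nheavy w.+1 t + nheavy w.+1 k + (nheavy w t + nheavy w k + (w == 0)).
  move: (odd_double_half a) (odd_double_half b) (odd_double_half c).
  move: (a./2) (b./2) (c./2) (odd a) (odd b) (odd c).
  move=> x y z [] [] [] /= <- <- <- at2 bt2 abt abc; try lia.
  - rewrite !add1n !nheavy_doubleS add0n nheavy_double /=.
    by have := IH1 x.+1 y z; have := IH0 x y.+1 z; have := mono y; lia.
  - rewrite !add1n !nheavy_doubleS add0n nheavy_double /=.
    by have := IH1 x.+1 y z; have := IH0 x y z.+1; have := mono z; lia.
  - rewrite !add1n !nheavy_doubleS add0n nheavy_double /=.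
    by have := IH1 x y.+1 z; have := IH0 x y z.+1; have := mono z; lia.
  - rewrite !add0n !nheavy_double /=.
    by have := IH1 x y z; have := IH0 x y z; lia.
case: (odd m) E3 => /= E3 at3 bt3 abt abc.
  have -> : n - (true + t.*2).+1 = k.*2 by lia.
  wlog ab : a b at3 bt3 abt abc halve / b <= a.
    by move=> wl; case: (leqP b a) => ab; [exact: wl | have := wl b a; lia].
  (* If [a] equals the new third, [b + c] is one more than [k.*2], and [nheavy_superaddS] absorbs
     that unit. *)
  have [a_max|a_lt] := eqVneq a t.*2.+1.
    case: b c bt3 abt abc ab {halve} => [|b] [|c] bt3 abt abc ab; try lia.
    have := nheavy_superaddS w b c; have -> : (b + c).+1 = k.*2 by lia.
    by rewrite a_max add1n; lia.
  (* For [w = 0], the extra unit in [halve] is paid for by [t] itself, which is counted in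
     [nheavy w.+1 t.+1]. *)
  have t_gt0 : 0 < popcount t by apply: popcount_gt0; lia.
  rewrite add1n nheavy_doubleS nheavy_double nheavyS /=.
  by apply: leq_trans (halve _ _ _ _) _; lia.
have -> : n - (false + t.*2).+1 = k.*2.+1 by lia.
have [ab_min|ab_gt] := eqVneq (a + b) t.*2.+1.
  have -> : c = k.*2.+1 by lia.
  case: a b at3 bt3 abt abc ab_min {halve} => [|a] [|b] at3 bt3 abt abc ab_min; try lia.
  by have := nheavy_superaddS w a b; rewrite (_ : (a + b).+1 = t.*2) ?add0n; lia.
have k_gt0 : 0 < popcount k by apply: popcount_gt0; lia.
rewrite add0n nheavy_doubleS nheavy_double nheavyS /=.
by apply: leq_trans (halve _ _ _ _) _; lia.
Qed.

(* The greedy step: parts are merged as long as their sum stays below the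
   relevant bound, after which at most three of them are left. *)
Lemma nheavy_parts m w c (s : seq nat) :
  c <= 2 ^ m - (third m).+1 -> all (fun a => a <= third m) s -> c + sumn s <= 2 ^ m ->
  nheavy w.+1 c + sumn [seq nheavy w.+1 a | a <- s]
    <= nheavy w.+1 (third m) + nheavy w.+1 (2 ^ m - (third m).+1).
Proof.
have lt3 := third_lt m.
move: {2}(size s) (leqnn (size s)) => k; elim: k c s => [|k IHk] c [|a [|b s]] //=.
- by move=> _ cm _ _; rewrite addn0 (leq_trans (leq_nheavy w.+1 cm)) ?leq_addl.
- by move=> _ cm _ _; rewrite addn0 (leq_trans (leq_nheavy w.+1 cm)) ?leq_addl.
- by move=> _ cm /andP [am _] _; rewrite addn0 addnC leq_add // leq_nheavy.
rewrite ltnS => sz cm /and3P [am bm alls] Esum.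
have [ab|ab] := leqP (a + b) (third m).
  have := IHk c ((a + b) :: s) sz cm; rewrite /= ab alls => /(_ isT).
  by have := nheavy_superadd w.+1 a b; lia.
case: s sz alls Esum => [|d s] /= sz alls Esum.
  have := @nheavy_three m w.+1 a b (2 ^ m - (a + b)) am bm ab.
  by have := @leq_nheavy w.+1 c (2 ^ m - (a + b)); lia.
case/andP: alls => dm alls; have := thirdE m => E3.
have cd : c + d <= 2 ^ m - (third m).+1 by lia.
have := IHk (c + d) [:: a, b & s] sz cd; rewrite /= am bm alls => /(_ isT).
by have := nheavy_superadd w.+1 c d; lia.
Qed.

(** * Binomial coefficients and widths along the standard path *)

Lemma nheavy_pow2 m w : nheavy w (2 ^ m.+1) = nheavy w (2 ^ m) + nheavy w.-1 (2 ^ m).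
Proof. by rewrite expnS mul2n -addnn nheavy_top. Qed.

Lemma nheavy_pow2_binomial m w : nheavy w (2 ^ m) = nheavy w.+1 (2 ^ m) + 'C(m, w).
Proof.
elim: m w => [|m IHm] w.
  by rewrite expn0 !nheavyS !nheavy0 /popcount big_ord0; case: w.
case: w => [|w]; last first.
  by rewrite !nheavy_pow2 binS; have := IHm w.+1; have := IHm w; rewrite /=; lia.
by rewrite !nheavy_pow2 bin0 !nheavy0l; have := IHm 0; rewrite nheavy0l bin0; lia.
Qed.

Lemma nheavy_pow2_eq0 m : nheavy m.+1 (2 ^ m) = 0.
Proof.
elim: m => [|m IHm]; first by rewrite expn0 nheavyS nheavy0 /popcount big_ord0.
by rewrite nheavy_pow2 IHm addn0; have := nheavyW m.+1 (2 ^ m); rewrite IHm; lia.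
Qed.

(** The width bound at position [i] of the standard path, whose two components have [i] and
    [2 ^ m - i.+1] coordinates. *)
Definition profile (m w i : nat) : nat :=
  nheavy w (2 ^ m) - (nheavy w i + nheavy w (2 ^ m - i.+1)).

Lemma profileE m w i : i < 2 ^ m ->
  nheavy w (2 ^ m) = profile m w i + (nheavy w i + nheavy w (2 ^ m - i.+1)).
Proof.
move=> im; rewrite subnK // (leq_trans (nheavy_superadd _ _ _)) // leq_nheavy //; lia.
Qed.

Lemma profile_sym m w i : i < 2 ^ m -> profile m w (2 ^ m - i.+1) = profile m w i.
Proof.
move=> im; rewrite /profile addnC; congr (_ - (_ + _)); congr nheavy; lia.
Qed.

Lemma profile0 m i : i < 2 ^ m -> profile m 0 i = 1.
Proof. by move=> im; have := profileE 0 im; rewrite !nheavy0l; lia. Qed.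

(** Both [2 ^ m + i] and its mirror position lose their top bit, which lowers [w.+1] to [w]. The
    full blocks left over differ by the integers below [2 ^ m] of weights w - 1 and w, and Pascal's
    rule gives the binomial. *)
Lemma profile_step m w i : i < 2 ^ m ->
  profile m.+2 w.+1 (2 ^ m + i) = 'C(m.+1, w) + profile m w i.
Proof.
move=> im; have Em := expnS 2 m; have Em1 := expnS 2 m.+1.
have im2 : 2 ^ m + i < 2 ^ m.+2 by lia.
have := profileE w.+1 im2; have := profileE w im.
have -> : 2 ^ m.+2 - (2 ^ m + i).+1 = 2 ^ m.+1 + (2 ^ m - i.+1) by lia.
rewrite !nheavy_top; try lia.
rewrite (nheavy_pow2 m.+1) /= (nheavy_pow2 m w) (nheavy_pow2 m w.+1) /=.
have := nheavy_pow2_binomial m w; case: w => [|w] /=; first by rewrite !bin0; lia.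
by rewrite binS; have := nheavy_pow2_binomial m w; lia.
Qed.

Lemma profile_low m w i : i < 2 ^ m ->
  profile m.+2 w.+1 i <= profile m.+2 w.+1 (2 ^ m + i).
Proof.
move=> im; have Em := expnS 2 m; have Em1 := expnS 2 m.+1.
apply: leq_sub2l.
have -> : 2 ^ m.+2 - (2 ^ m + i).+1 = 2 ^ m.+1 + (2 ^ m - i.+1) by lia.
have -> : 2 ^ m.+2 - i.+1 = 2 ^ m.+1 + (2 ^ m + (2 ^ m - i.+1)) by lia.
rewrite !nheavy_top /=; try lia.
have := nheavy_diff_mono w (ltnW im); have := nheavy_pred w (2 ^ m - i.+1); lia.
Qed.

Lemma thirdSS m : third m.+2 = 2 ^ m + third m.
Proof. by rewrite !thirdS /=; have := thirdE m; case: (odd m) => /=; lia. Qed.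

(** Symmetry brings [i] to the lower half and [profile_low] to the second quarter, where
    [profile_step] goes from [m.+2] to [m]; by [thirdSS], [third] follows the same recursion. *)
Lemma profile_max m w i : i < 2 ^ m -> profile m w i <= profile m w (third m).
Proof.
elim/ltn_ind: m w i => m IHm w i im.
case: w => [|w]; first by rewrite !profile0 // third_lt.
case: m IHm im => [|[|m]] IHm im.
- by case: i im.
- case: i im => [|[|i]] // im; by rewrite -(@profile_sym 1 w.+1 1).
wlog i2 : i im / i < 2 ^ m.+1.
  move=> wl; case: (ltnP i (2 ^ m.+1)) => i2; first exact: wl.
  rewrite -profile_sym //; apply: wl; have := expnS 2 m.+1; lia.
rewrite thirdSS profile_step ?third_lt //; have := expnS 2 m => Em.
have step j : j < 2 ^ m -> 
    profile m.+2 w.+1 (2 ^ m + j) <= 'C(m.+1, w) + profile m w (third m).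
  by move=> jm; rewrite profile_step // leq_add2l IHm.
case: (ltnP i (2 ^ m)) => [i1|i1]; first exact: leq_trans (profile_low w i1) (step _ i1).
by have := step (i - 2 ^ m); rewrite subnKC //; apply; lia.
Qed.

(** Each [profile_step] lowers [m] by two and both [r] and [m - r] by one; here [r] reaches 0
    first. *)
Lemma profile_third_low m r : 2 * r + 1 <= m ->
  profile m (m - r) (third m) = \sum_(0 <= j < r.+1) 'C(m - 2 * j - 1, r - j).
Proof.
elim: r m => [|r IHr] [|[|m]] // rm; try lia.
- rewrite big_nat1 /profile (_ : third 1 = 0) // expn1 !nheavyS !nheavy0.
  by rewrite /popcount big_ord0 big_ord1.
- rewrite big_nat1 !subn0 subn1 /= bin0 thirdSS profile_step ?third_lt // binn.
  by rewrite /profile nheavy_pow2_eq0.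
rewrite big_nat_recl // !subn0 subn1 /= (_ : m.+2 - r.+1 = (m - r).+1); last by lia.
rewrite thirdSS profile_step ?third_lt // IHr; last by lia.
rewrite -bin_sub; last by lia.
by congr ('C(_, _) + _); [lia | apply: eq_bigr => j _; congr 'C(_, _); lia].
Qed.

(** Here [m - r] reaches 0 first, and [profile0] supplies the leading 1. *)
Lemma profile_third_high m r : r <= m -> m < 2 * r + 1 ->
  profile m (m - r) (third m) = 1 + \sum_(0 <= j < m - r) 'C(m - 2 * j - 1, r - j).
Proof.
move=> /subnKC <-; rewrite addKn; move: (m - r) => d.
elim: d r => [|w IHw] [|r] rm; try lia.
- by rewrite big_geq // addn0 profile0 // third_lt.
- by rewrite big_geq // addn0 profile0 // third_lt.
rewrite addSn addnS big_nat_recl // !subn0 subn1 /= thirdSS profile_step ?third_lt //.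
rewrite IHw; last by lia.
rewrite addnCA; congr (_ + (_ + _)).
  by rewrite -bin_sub; [congr 'C(_, _); lia | lia].
by apply: eq_bigr => j _; congr 'C(_, _); lia.
Qed.

(** * Separating nodes of a tree *)

Section TreeSeparators.
Variables (V : finType) (g : rel V).
Hypothesis tree_g : is_tree g.

Lemma delete_edge_sym e : ssrbool.symmetric (delete_edge g e).
Proof. by case: tree_g => g_sym _ _ _ _ x y; rewrite /delete_edge /= g_sym setUC. Qed.

(** Connectedness makes the two sides of the edge cover the tree ([reach]), acyclicity makes them
    disjoint ([apart]). *)
Lemma far_component_edge u v : g u v ->
  far_component g [set u; v] v = ~: far_component g [set u; v] u.
Proof.
case: tree_g => g_sym g_irr _ g_conn g_acyc guv; set e := [set u; v].
have del_sym : connect_sym (delete_edge g e).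
  by apply: sym_connect_sym; exact: delete_edge_sym.
have reach x : connect (delete_edge g e) u x || connect (delete_edge g e) v x.
  have /connectP [p gp ->] := g_conn u x.
  pose near z := connect (delete_edge g e) u z || connect (delete_edge g e) v z.
  suff near_last z : near z -> path g z p -> near (last z p).
    by apply: near_last; rewrite // /near connect0.
  elim: p z {gp} => //= y p IHp z near_z /andP [gzy gp]; apply: IHp => //.
  have [zy|zy] := eqVneq [set z; y] e; last first.
    have dzy : connect (delete_edge g e) z y.
      by apply: connect1; rewrite /delete_edge /= gzy zy.
    by rewrite /near; case/orP: near_z => /connect_trans ->; rewrite ?orbT.
  have : y \in e by rewrite -zy !inE eqxx orbT.
  by rewrite !inE /near => /orP [] /eqP ->; rewrite connect0 ?orbT.
have apart : ~~ connect (delete_edge g e) u v.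
  apply/negP => /connectP [p0 dp0 v_last0].
  case: (shortenP dp0) v_last0 => p dp uniq_p _ v_last.
  (* A simple path avoiding the edge closes up with it to a cycle, so it has at most two nodes; it
     would then be a loop or the deleted edge itself. *)
  have : size (u :: p) <= 2.
    apply: g_acyc; rewrite /ucycle uniq_p andbT /= rcons_path -v_last g_sym guv andbT.
    by apply: sub_path dp => x y /andP [].
  case: p dp v_last {uniq_p} => [|y [|z p]] //= dp v_last _.
    by rewrite v_last g_irr in guv.
  by move: dp; rewrite -v_last /delete_edge /= eqxx andbF.
apply/setP => x; rewrite !inE negbK; have := reach x.
case: (boolP (connect _ u x)) => ux /=; last by move=> ->.
by move=> _; apply: contra apart => vx; apply: connect_trans ux _; rewrite del_sym.
Qed.

Lemma incident_edgeP v e :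
  reflect (exists2 u, g v u & e = [set v; u]) (e \in incident_edges g v).
Proof.
case: tree_g => g_sym _ _ _ _; apply: (iffP idP) => [|[u gvu ->]].
  rewrite inE => /andP [/imsetP [[x y] /= gxy ->]]; rewrite !inE in gxy *.
  case/orP=> /eqP ->; first by exists y.
  by exists x; rewrite 1?g_sym 1?setUC.
by rewrite !inE eqxx andbT; apply/imsetP; exists (v, u); rewrite ?inE.
Qed.

(* A deepest node whose subtree is still heavy, seen from an arbitrary root. *)
Lemma tree_separator (heavy : pred {set V}) :
  (forall A B : {set V}, A \subset B -> heavy A -> heavy B) ->
  exists v, (forall e, e \in incident_edges g v -> ~~ heavy (far_component g e v)) \/
    exists2 e0, e0 \in incident_edges g v & heavy (~: far_component g e0 v) /\
      forall e, e \in incident_edges g v -> e != e0 -> ~~ heavy (far_component g e v).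
Proof.
move=> heavyS; have [g_sym g_irr V_gt0 g_conn _] := tree_g.
(* A pair [(u, v)] directs an edge towards a heavy side, that of [v]; the separator is the head of a
   pair whose heavy side is smallest. *)
pose dir (p : V * V) := g p.1 p.2 && heavy (far_component g [set p.1; p.2] p.1).
case: (pickP dir) => [p0 dir0|no_dir]; last first.
  have /card_gt0P [v _] := V_gt0; exists v; left => e /incident_edgeP [u gvu ->].
  by have := no_dir (v, u); rewrite /dir /= gvu => /negbT.
case: (arg_minnP (fun p => #|far_component g [set p.1; p.2] p.1|) dir0) => -[u v].
rewrite {1}/dir /= => /andP [guv heavy_uv] min_uv; exists v; right; exists [set u; v].
  by apply/incident_edgeP; exists u; rewrite 1?g_sym 1?setUC.
rewrite far_component_edge // setCK; split=> // e e_v neq_e; apply/negP => heavy_e.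
have [x gvx def_e] := incident_edgeP _ _ e_v.
(* A second heavy component at [v] would lie strictly inside the minimal one, as it misses [v]. *)
have := min_uv (v, x); rewrite /dir /= gvx -def_e heavy_e => /(_ isT).
rewrite leqNgt => /negP; apply; apply: proper_card; apply/properP; split.
  apply/subsetP => y ye; rewrite -[_ _ u]setCK -far_component_edge // inE.
  apply: contra neq_e => yuv; apply/eqP.
  by apply: (far_component_disjoint g_conn _ _ ye yuv); rewrite ?def_e !inE eqxx ?orbT.
exists v; last by rewrite inE connect0.
by rewrite -[_ _ u]setCK -far_component_edge // !inE connect0.
Qed.

(** Double counting: the components at [v] are disjoint and miss [v], so every index is counted at
    most once. *)
Lemma leq_sum_card_preimages (I : finType) (w : I -> V) v :
  \sum_(e in incident_edges g v) #|w @^-1: far_component g e v|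
    + #|w @^-1: [set v]| <= #|I|.
Proof.
have [_ _ _ g_conn _] := tree_g.
under eq_bigr => e _ do rewrite -sum1_card big_mkcond /=.
rewrite exchange_big -sum1_card [X in _ + X]big_mkcond -big_split /= -[#|I|]sum1_card.
apply: leq_sum => i _; rewrite !inE.
pose P := [pred e in incident_edges g v | w i \in far_component g e v].
have [e /andP [e_v ie]|no_e] := pickP P.
  have -> : (w i == v) = false.
    by apply: contraTF ie => /eqP ->; rewrite inE connect0.
  rewrite (bigD1 e) //= inE ie big1 ?addn0 // => e' /andP [e'_v neq_e]; rewrite inE.
  case: ifP => // ie'; case/eqP: neq_e.
  move: e_v e'_v; rewrite !inE => /andP [_ ve] /andP [_ ve'].
  exact: far_component_disjoint g_conn ve' ve ie' ie.
rewrite big1 => [|e e_v]; first by case: ifP.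
by have := no_e e; rewrite !inE in e_v *; rewrite e_v /= => ->.
Qed.
End TreeSeparators.

(* With [heavy] meaning at least [third m + 1] coordinates, the separator has at
   most one component with more than [third m] coordinates, and that component
   leaves room for [third m + 1] coordinates outside of it. *)
Lemma tree_parts m w (V : finType) (g : rel V) (om : 'I_(2 ^ m) -> V) :
  is_tree g -> exists v,
    \sum_(e in incident_edges g v) nheavy w.+1 #|om @^-1: far_component g e v|
      <= nheavy w.+1 (third m) + nheavy w.+1 (2 ^ m - (third m).+1).
Proof.
move=> tree_g; pose J e v := om @^-1: far_component g e v.
pose heavy (A : {set V}) := third m < #|om @^-1: A|.
have [A B AB|v v_sep] := @tree_separator V g tree_g heavy.
  by rewrite /heavy => /leq_trans; apply; rewrite subset_leq_card // preimsetS.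
exists v; have := leq_sum_card_preimages tree_g om v; rewrite card_ord => sum_n.
have small (s : seq {set V}) : (forall e, e \in s -> ~~ heavy (far_component g e v)) ->
    all (fun a => a <= third m) [seq #|J e v| | e <- s].
  move=> s_small; apply/allP => _ /mapP [e /s_small + ->]; by rewrite -leqNgt.
case: v_sep => [v_small|[e0 e0_v [e0_heavy v_small]]].
  have := @nheavy_parts m w 0 [seq #|J e v| | e <- enum (incident_edges g v)].
  rewrite leq0n small => [/(_ isT isT)|e]; last by rewrite mem_enum; exact: v_small.
  rewrite nheavy0 !add0n -map_comp !sumnE !big_map !big_enum; apply.
  by apply: leq_trans sum_n; rewrite leq_addr.
have := @nheavy_parts m w #|J e0 v| [seq #|J e v| | e <- enum (incident_edges g v :\ e0)].
rewrite small => [|e]; last by rewrite mem_enum in_setD1 => /andP [? ?]; exact: v_small.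
have J0 : #|J e0 v| <= 2 ^ m - (third m).+1.
  have := cardsC (J e0 v); rewrite card_ord /J -preimsetC.
  by move: e0_heavy; rewrite /heavy; lia.
rewrite J0 -map_comp !sumnE !big_map !big_enum => /(_ isT isT) parts.
rewrite (big_setD1 e0) //=; apply: parts.
rewrite (big_setD1 e0) //= in sum_n; by apply: leq_trans sum_n; rewrite leq_addr.
Qed.

(** * Dimensions of shortened Reed-Muller codes *)

Section ReedMullerDimension.
Import GRing.Theory.
Local Open Scope ring_scope.

Lemma addF2_self (x : 'F_2) : x + x = 0.
Proof. by apply: val_inj; case: x => [[|[|]]]. Qed.

(* The (u | u + v) description of the code RM(m - w, m), on functions of the
   integers below [2 ^ m]. *)
Fixpoint rm_fun (m w : nat) (f : nat -> 'F_2) : bool :=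
  if m is m'.+1 then rm_fun m' w.-1 f && rm_fun m' w (fun i => f i + f (2 ^ m' + i)%N)
  else (w == 0%N) || (f 0%N == 0).

Lemma eq_rm_fun m w f f' : (forall i, (i < 2 ^ m)%N -> f i = f' i) ->
  rm_fun m w f = rm_fun m w f'.
Proof.
elim: m w f f' => [|m IHm] w f f' ff' /=; first by rewrite ff'.
by congr (_ && _); apply: IHm => i im; rewrite !ff' // expnS; lia.
Qed.

Lemma rm_fun0 m w : rm_fun m w (fun=> 0).
Proof.
elim: m w => [|m IHm] w /=; first by rewrite eqxx orbT.
by rewrite IHm (@eq_rm_fun _ _ _ (fun=> 0)) ?IHm // => i _; rewrite addr0.
Qed.

Lemma rm_funD m w f f' :
  rm_fun m w f -> rm_fun m w f' -> rm_fun m w (fun i => f i + f' i).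
Proof.
elim: m w f f' => [|m IHm] w f f' /=.
  by case: eqP => //= _ /eqP -> /eqP ->; rewrite addr0.
case/andP=> f1 f2 /andP [f1' f2']; rewrite IHm //=.
rewrite (eq_rm_fun _ (fun i _ => addrACA _ _ _ _)); exact: IHm.
Qed.

Lemma rm_funZ m w a f : rm_fun m w f -> rm_fun m w (fun i => a * f i).
Proof.
elim: m w f => [|m IHm] w f /=; first by case: eqP => //= _ /eqP ->; rewrite mulr0.
case/andP=> f1 f2; rewrite IHm //=.
by rewrite (eq_rm_fun _ (fun i _ => esym (mulrDr _ _ _))) IHm.
Qed.

Lemma rm_fun_pred m w f : rm_fun m w f -> rm_fun m w.-1 f.
Proof.
elim: m w f => [|m IHm] w f /=; first by case: w => [|w] //= /eqP ->; rewrite eqxx orbT.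
by case/andP=> f1 f2; apply/andP; split; apply: IHm.
Qed.

Lemma rm_fun_lo m w f : rm_fun m.+1 w f -> rm_fun m w.-1 f.
Proof. by case/andP. Qed.

(** In (u | u + v), both u and v are at level [w.-1], hence so is their sum. *)
Lemma rm_fun_hi m w f : rm_fun m.+1 w f -> rm_fun m w.-1 (fun i => f (2 ^ m + i)%N).
Proof.
case/andP=> f_lo /rm_fun_pred f_sum.
rewrite -(@eq_rm_fun m w.-1 (fun i => f i + (f i + f (2 ^ m + i)%N))).
  exact: rm_funD.
by move=> i _; rewrite addrA addF2_self add0r.
Qed.

(** Bits are 0 or 1, so only the set of variables that occur matters. If the top variable is absent,
    the halves agree and v = 0; if it is present, u = 0 and v is the monomial without it. *)
Lemma rm_fun_monomial m w (e : nat -> nat) :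
  (w + \sum_(j < m) (0 < e j) <= m)%N ->
  rm_fun m w (fun i => \prod_(j < m) bit i j ^+ e j).
Proof.
elim: m w => [|m IHm] w; first by rewrite big_ord0 addn0 leqn0 /= => ->.
rewrite big_ord_recr /= => le_w.
have sum_le : (\sum_(j < m) (0 < e j) <= m)%N.
  rewrite -[X in (_ <= X)%N](card_ord m) -sum1_card leq_sum // => j _.
  by case: (0 < e j)%N.
pose f i : 'F_2 := \prod_(j < m) bit i j ^+ e j.
have lo i : (i < 2 ^ m)%N -> \prod_(j < m.+1) bit i j ^+ e j = f i * 0 ^+ e m.
  by move=> im; rewrite big_ord_recr /= {2}/bit divn_small.
have hi i : (i < 2 ^ m)%N -> \prod_(j < m.+1) bit (2 ^ m + i) j ^+ e j = f i.
  move=> im; rewrite big_ord_recr /= {2}/bit divnDl // divnn expn_gt0.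
  rewrite divn_small //= expr1n mulr1.
  by apply: eq_bigr => j _; rewrite /bit bit_top.
have [em|em] := posnP (e m); rewrite ?em /= ?addn0 in le_w lo.
  rewrite (@eq_rm_fun _ _ _ f) => [|i im]; last by rewrite lo // mulr1.
  rewrite IHm /=; last by case: w le_w => //=; lia.
  rewrite (@eq_rm_fun _ _ _ (fun=> 0)) ?rm_fun0 // => i im.
  by rewrite lo // hi // mulr1 addF2_self.
rewrite (@eq_rm_fun _ _ _ (fun=> 0)) => [|i im]; last first.
  by rewrite lo // expr0n gtn_eqF ?mulr0.
rewrite rm_fun0 (@eq_rm_fun _ _ _ f) ?IHm //=; first by lia.
by move=> i im; rewrite lo // hi // expr0n gtn_eqF // mulr0 add0r.
Qed.

(** Functionals [ev] on an abstract space let the recursion pass to a half without forming a shorter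
    code. Take the half with fewer points of [J]: the words vanishing on it are at level [w] on the
    other half, a complement of them embeds into it at level [w.-1], and [nheavy_add] combines the
    two bounds. *)
Lemma dim_rm_fun m w (vT : vectType 'F_2) (U : {vspace vT})
    (ev : nat -> 'Hom(vT, ('F_2)^o)) (J : pred nat) :
  (forall u, u \in U -> rm_fun m w (fun i => ev i u)) ->
  (forall u i, u \in U -> (i < 2 ^ m)%N -> ~~ J i -> ev i u = 0) ->
  (forall u, u \in U -> (forall i, (i < 2 ^ m)%N -> ev i u = 0) -> u = 0) ->
  (\dim U <= nheavy w (\sum_(i < 2 ^ m) J i))%N.
Proof.
elim: m w U ev J => [|m IHm] w U ev J U_rm U_J U_inj.
  have [U0|] := eqVneq U 0%VS; first by rewrite U0 dimv0.
  rewrite -vpick0 => pick_neq0; have pickU := memv_pick U.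
  have ev_neq0 : ev 0%N (vpick U) != 0.
    by apply: contra pick_neq0 => /eqP ev0; apply/eqP/U_inj => // -[].
  have J0 : J 0%N by apply: contraNT ev_neq0 => /U_J -> //.
  have -> : w = 0%N by apply/eqP; have := U_rm _ pickU; rewrite /= (negPf ev_neq0) orbF.
  rewrite nheavy0l expn0 big_ord1 J0.
  have <- : \dim (ev 0%N @: U) = \dim U.
    apply: limg_dim_eq; apply/eqP; rewrite -subv0; apply/subvP => u.
    rewrite memv_cap memv_ker memv0 => /andP [uU /eqP u0]; apply/eqP/U_inj => // -[] //.
  by rewrite (leq_trans (dimvS (subvf _))) // dimvf.
pose lo i := ev i; pose hi i := ev (2 ^ m + i)%N.
have card_split : (\sum_(i < 2 ^ m.+1) J i
    = \sum_(i < 2 ^ m) J i + \sum_(i < 2 ^ m) J (2 ^ m + i))%N.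
  by rewrite expnS mul2n -addnn big_split_ord.
have split_lt i : (i < 2 ^ m.+1)%N ->
    (i < 2 ^ m)%N \/ exists2 k, (k < 2 ^ m)%N & i = (2 ^ m + k)%N.
  rewrite expnS; case: (ltnP i (2 ^ m)) => [|im i2]; [by left | right].
  by exists (i - 2 ^ m)%N; lia.
have in_lo i : (i < 2 ^ m)%N -> (i < 2 ^ m.+1)%N by rewrite expnS; lia.
have in_hi i : (i < 2 ^ m)%N -> (2 ^ m + i < 2 ^ m.+1)%N by rewrite expnS; lia.
pose K (h : nat -> 'Hom(vT, ('F_2)^o)) := (\bigcap_(i < 2 ^ m) lker (h i))%VS.
have memK h u : u \in K h <-> forall i, (i < 2 ^ m)%N -> h i u = 0.
  rewrite memvE; split=> [/subv_bigcapP Ku i im | Ku].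
    by have := Ku (Ordinal im) isT; rewrite -memvE memv_ker => /eqP.
  by apply/subv_bigcapP => i _; rewrite -memvE memv_ker Ku.
have inK h u : u \in (U :\: K h)%VS -> (forall i, (i < 2 ^ m)%N -> h i u = 0) -> u = 0.
  by move=> uUK /memK uK; apply/eqP; rewrite -memv0 -(capv_diff U (K h)) memv_cap uUK.
have subD h u : u \in (U :\: K h)%VS -> u \in U by apply: subvP; exact: diffvSl.
rewrite card_split; set a := (\sum_(i < 2 ^ m) J i)%N.
set b := (\sum_(i < 2 ^ m) J (2 ^ m + i))%N.
have [ab|/ltnW ba] := leqP a b.
  rewrite (leq_trans _ (nheavy_add w ab)) // -(dimv_cap_compl U (K lo)) addnC leq_add //.
    apply: (IHm _ _ lo J) => [u /subD /U_rm /rm_fun_lo //|u i /subD uU /in_lo|u /inK //].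
    exact: U_J.
  apply: (IHm _ _ hi (fun i => J (2 ^ m + i)%N)) => [u|u i|u];
    rewrite memv_cap => /andP [uU /memK u0].
  - have /andP [_ u_sum] := U_rm _ uU.
    by rewrite -(@eq_rm_fun m w (fun i => lo i u + hi i u)) // => i im; rewrite u0 // add0r.
  - by move=> /in_hi im; exact: U_J.
  - move=> hi0; apply: U_inj => // i /split_lt [|[k km ->]]; [exact: u0 | exact: hi0].
rewrite addnC (leq_trans _ (nheavy_add w ba)) // -(dimv_cap_compl U (K hi)) addnC leq_add //.
  apply: (IHm _ _ hi (fun i => J (2 ^ m + i)%N)) => [u|u i|u /inK //].
    by move=> /subD /U_rm /rm_fun_hi.
  by move=> /subD uU /in_hi; exact: U_J.
apply: (IHm _ _ lo J) => [u|u i|u]; rewrite memv_cap => /andP [uU /memK u0].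
- have /andP [_ u_sum] := U_rm _ uU.
  by rewrite -(@eq_rm_fun m w (fun i => lo i u + hi i u)) // => i im; rewrite u0 // addr0.
- by move=> /in_lo im; exact: U_J.
- move=> lo0; apply: U_inj => // i /split_lt [|[k km ->]]; [exact: lo0 | exact: u0].
Qed.

End ReedMullerDimension.

(** * Subcodes supported on a set of coordinates *)

Section SupportedSubcode.
Variables (F : fieldType) (I : finType).
Import GRing.Theory.
Local Open Scope ring_scope.

Definition coordinate (i : I) (c : word F I) : F^o := c i.

Fact coordinate_linear (i : I) : linear (coordinate i).
Proof. by move=> a c d; rewrite /coordinate !ffunE. Qed.

HB.instance Definition _ (i : I) :=
  GRing.isLinear.Build F (word F I) F^o *:%R (coordinate i) (coordinate_linear i).

(** Unlike shortenings, these subcodes lie in one space for all [J] and can be compared by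
    inclusion; restriction to [J] is injective on them. *)
Definition supported (C : {vspace word F I}) (J : {set I}) : {vspace word F I} :=
  (C :&: lker (linfun (restrict (~: J))))%VS.

Lemma supportedP (C : {vspace word F I}) (J : {set I}) c :
  reflect (c \in C /\ forall i, i \notin J -> c i = 0) (c \in supported C J).
Proof.
rewrite memv_cap memv_ker lfunE; apply: (iffP andP) => -[-> c0]; split=> //.
  move=> i iJ; rewrite -in_setC in iJ; move/eqP/ffunP/(_ (exist _ i iJ)): c0.
  by rewrite !ffunE.
by apply/eqP/ffunP => -[i iJ]; rewrite !ffunE /= c0 // -in_setC.
Qed.

Lemma supportedS (C : {vspace word F I}) (J J' : {set I}) :
  J \subset J' -> (supported C J <= supported C J')%VS.
Proof.
move=> JJ'; apply/subvP => c /supportedP [cC c0]; apply/supportedP; split=> // i iJ'.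
by apply: c0; apply: contra iJ'; exact: subsetP.
Qed.

Lemma dim_shortening (C : {vspace word F I}) (J : {set I}) :
  \dim (shortening C J) = \dim (supported C J).
Proof.
apply: limg_dim_eq; apply/eqP; rewrite -subv0; apply/subvP => c.
rewrite memv_cap memv_ker memv0 lfunE => /andP [/supportedP [_ c0] /eqP/ffunP cJ].
apply/eqP/ffunP => i; rewrite ffunE; case: (boolP (i \in J)) => iJ; last exact: c0.
by have := cJ (exist _ i iJ); rewrite !ffunE.
Qed.

(* Each word of the chain has a new last coordinate (for the order given by
   [s]) in its support, so it is independent of the previous ones. *)
Lemma dim_supported_chain (C : {vspace word F I}) (s : I -> nat) (P : pred nat) n :
  (forall j, (j < n)%N -> P j -> exists2 c, c \in C &
     (exists2 i, s i = j & c i != 0) /\ forall i, c i != 0 -> (s i <= j)%N) ->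
  (\sum_(j < n) P j <= \dim (supported C [set i | (s i < n)%N]))%N.
Proof.
elim: n => [|n IHn] words; first by rewrite big_ord0.
rewrite big_ord_recr /=; have {IHn} := IHn (fun j jn => words j (ltnW jn)).
set U := supported _ _; set W := supported _ _ => le_U.
have UW : (U <= W)%VS by apply: supportedS; apply/subsetP => i; rewrite !inE => /ltnW.
case Pn : (P n); last by rewrite addn0 (leq_trans le_U) ?dimvS.
have [c cC [[i si ci] c_le]] := words n (ltnSn n) Pn.
have cW : c \in W.
  by apply/supportedP; split=> // k; rewrite inE ltnS => kn; apply: contraNeq kn => /c_le.
have cU : c \notin U.
  by apply: contra ci => /supportedP [_ c0]; apply/eqP/c0; rewrite inE si ltnn.
rewrite addn1 (leq_ltn_trans le_U) // ltnNge; apply: contra cU => WU.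
by have /eqP -> : U == W by rewrite eqEdim UW.
Qed.

End SupportedSubcode.

(** * Both dimension bounds for Reed-Muller codes *)

Section ReedMullerWords.
Import GRing.Theory.
Local Open Scope ring_scope.

Lemma dim_shortening_RM_le r m (J : {set 'I_(2 ^ m)}) : (r <= m)%N ->
  (\dim (shortening (RM r m) J) <= nheavy (m - r) #|J|)%N.
Proof.
move=> rm; rewrite dim_shortening.
have n_gt0 : (0 < 2 ^ m)%N by rewrite expn_gt0.
(* [dim_rm_fun] indexes by all integers, so those from [2 ^ m] on are sent to the default index
   0. *)
pose at_ i : 'I_(2 ^ m) := insubd (Ordinal n_gt0) i.
have at_ord (i : 'I_(2 ^ m)) : at_ i = i by rewrite /at_ valKd.
have -> : #|J| = (\sum_(i < 2 ^ m) (at_ i \in J))%N.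
  by rewrite -sum1_card big_mkcond; apply: eq_bigr => i _; rewrite at_ord; case: ifP.
apply: (@dim_rm_fun m (m - r) _ (supported (RM r m) J)
  (fun i => linfun (coordinate (at_ i))) (fun i => at_ i \in J)).
- move=> u /supportedP [/mem_RM [f sz_f ->] _].
  pose mono (mu : 'X_{1..m}) i := \prod_(j < m) bit i j ^+ mu j.
  pose rmsum s := fun i => \sum_(mu <- s) f@_mu * mono mu i.
  rewrite (@eq_rm_fun _ _ _ (rmsum (msupp f))) => [|i im]; last first.
    rewrite lfunE /= /coordinate ffunE mevalE /rmsum /mono /at_.
    by rewrite (_ : val (insubd _ i) = i) // val_insubd im.
  have : {subset msupp f <= msupp f} by [].
  elim: {1 3}(msupp f) => [|mu s IHs] sub_s.
    by rewrite (@eq_rm_fun _ _ _ (fun=> 0)) ?rm_fun0 // => i _; rewrite /rmsum big_nil.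
  rewrite (@eq_rm_fun _ _ _ (fun i => f@_mu * mono mu i + rmsum s i)); last first.
    by move=> i _; rewrite /rmsum big_cons.
  apply: rm_funD; last by apply: IHs => nu nu_s; rewrite sub_s // inE nu_s orbT.
  apply: rm_funZ; pose e j := if insub j is Some k then mu (k : 'I_m) else 0%N.
  have e_ord (j : 'I_m) : e j = mu j by rewrite /e valK.
  rewrite (@eq_rm_fun _ _ _ (fun i => \prod_(j < m) bit i j ^+ e j)); last first.
    by move=> i _; apply: eq_bigr => j _; rewrite e_ord.
  apply: rm_fun_monomial; have : (mdeg mu <= r)%N.
    by rewrite -ltnS (leq_trans _ sz_f) // msize_mdeg_lt // sub_s // mem_head.
  rewrite mdegE => deg_mu.
  rewrite -leq_subRL ?leq_subr // subKn // (leq_trans _ deg_mu) //.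
  by apply: leq_sum => j _; rewrite e_ord; case: (mu j).
- move=> u i /supportedP [_ u0] im iJ; rewrite lfunE; exact: u0.
- move=> u /supportedP [_ u0] ev0; apply/ffunP => i; rewrite ffunE.
  by have := ev0 i (ltn_ord i); rewrite lfunE /= /coordinate at_ord.
Qed.

Lemma bit_rev m k i : (k < m)%N -> (i < 2 ^ m)%N ->
  odd ((2 ^ m - i.+1) %/ 2 ^ k) = ~~ odd (i %/ 2 ^ k).
Proof.
move=> km im; have k_gt0 : (0 < 2 ^ k)%N by rewrite expn_gt0.
have Em : (2 ^ m = 2 * 2 ^ (m - k.+1) * 2 ^ k)%N.
  by rewrite -expnS -expnD; congr expn; lia.
have := divn_eq i (2 ^ k); have := ltn_pmod i k_gt0.
set q := (i %/ _)%N; set rho := (i %% _)%N => rho_lt def_i.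
have q_lt : (q < 2 * 2 ^ (m - k.+1))%N by rewrite ltn_divLR // -Em.
have -> : (2 ^ m - i.+1
    = (2 * 2 ^ (m - k.+1) - q.+1) * 2 ^ k + (2 ^ k - rho.+1))%N.
  by rewrite Em def_i mulnBl mulSn; have := leq_mul q_lt (leqnn (2 ^ k)); lia.
by rewrite divnMDl // divn_small; lia.
Qed.

Lemma bits_sub_leq m x y : (x < 2 ^ m)%N ->
  (forall k, (k < m)%N -> odd (x %/ 2 ^ k) -> odd (y %/ 2 ^ k)) -> (x <= y)%N.
Proof.
elim: m x y => [|m IHm] x y; first by case: x.
rewrite expnS => xm sub_xy; have := sub_xy 0%N isT; rewrite !divn1.
have : (x./2 <= y./2)%N.
  apply: IHm => [|k km]; first by lia.
  by have := sub_xy k.+1 km; rewrite expnS !divnMA !divn2.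
move: (odd_double_half x) (odd_double_half y).
by case: (odd x) (odd y) => [] [] /=; lia.
Qed.

Lemma msize_prod_linear m (s : seq 'I_m) (a : 'F_2) :
  (msize (\prod_(k <- s) ('X_k + a%:MP)) <= (size s).+1)%N.
Proof.
elim: s => [|k s IHs]; first by rewrite big_nil msize1.
rewrite big_cons; set p := 'X_k + _; set q := \prod_(_ <- _) _ in IHs *.
have sz_p : (msize p <= 2)%N.
  by rewrite (leq_trans (msizeD_le _ _)) // msizeX mdeg1 geq_max msizeC; case: eqP.
have [->|nz_p] := eqVneq p 0; first by rewrite mul0r msize0.
have [->|nz_q] := eqVneq q 0; first by rewrite mulr0 msize0.
by rewrite msizeM // -subn1 leq_subLR (leq_trans (leq_add sz_p IHs)).
Qed.

(* The product of the [x_k + 1] (resp. the [x_k]) over the zero bits [k] of [j]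
   vanishes outside of the points (resp. the complements of the points) whose
   bits are all bits of [j]. *)
Lemma RM_word r m (rev : bool) j : (j < 2 ^ m)%N -> (m - r <= popcount j)%N ->
  let s i := if rev then (2 ^ m - i.+1)%N else i in
  exists2 c, c \in RM r m &
    (exists2 i : 'I_(2 ^ m), s i = j & c i != 0) /\
    forall i : 'I_(2 ^ m), c i != 0 -> (s i <= j)%N.
Proof.
move=> jm heavy_j s.
have sP i : (i < 2 ^ m)%N -> (s i < 2 ^ m)%N /\ s (s i) = i.
  by rewrite /s; case: (rev); lia.
pose zeros := [seq k : 'I_m <- enum 'I_m | ~~ odd (j %/ 2 ^ k)].
pose f : {mpoly 'F_2[m]} := \prod_(k <- zeros) ('X_k + ((~~ rev)%:R)%:MP).
have f_at (i : 'I_(2 ^ m)) :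
    evaluation_word f i = \prod_(k <- zeros) (bit i k + (~~ rev)%:R).
  rewrite ffunE rmorph_prod /=; apply: eq_bigr => k _.
  by rewrite mevalD mevalXU mevalC.
have factor (i : 'I_(2 ^ m)) (k : 'I_m) :
    bit i k + (~~ rev)%:R = (~~ odd (s i %/ 2 ^ k))%:R.
  rewrite /bit /s; case: (rev); last by case: odd; apply: val_inj.
  by rewrite bit_rev // negbK addr0.
have f_neq0 (i : 'I_(2 ^ m)) : (evaluation_word f i != 0)
    = all (fun k : 'I_m => ~~ odd (s i %/ 2 ^ k)) zeros.
  rewrite f_at prodf_seq_neq0; apply: eq_all => k /=; rewrite factor.
  by case: odd.
exists (evaluation_word f).
  apply/mem_RM; exists f => //; apply: leq_trans (msize_prod_linear _ _) _; rewrite ltnS.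
  suff : (popcount j + size zeros = m)%N by lia.
  have -> : size zeros = (\sum_(k < m) ~~ odd (j %/ 2 ^ k))%N.
    rewrite -sum1_size big_filter big_enum_cond big_mkcond.
    by apply: eq_bigr => k _ /=; case: odd.
  rewrite (popcountE jm) -big_split /= (eq_bigr (fun=> 1%N)) => [|k _]; last by case: odd.
  by rewrite sum1_card card_ord.
split=> [|i].
  have [sj ssj] := sP j jm; exists (Ordinal sj) => //.
  by rewrite f_neq0 /= ssj; apply/allP => k; rewrite mem_filter => /andP [].
rewrite f_neq0 => /allP s_bits; apply: (@bits_sub_leq m) => [|k km].
  by have [] := sP i.
have := s_bits (Ordinal km); rewrite mem_filter mem_enum /= andbT.
by case: (odd (j %/ _)) => // /(_ isT) /negPf ->.
Qed.

(** The words of [RM_word] for heavy [j < n] form a chain; with [rev] the order is reversed and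
    their supports lie in the last [n] coordinates. *)
Lemma dim_supported_RM r m (rev : bool) n : (n <= 2 ^ m)%N ->
  let s i := if rev then (2 ^ m - i.+1)%N else i in
  (nheavy (m - r) n <= \dim (supported (RM r m) [set i : 'I_(2 ^ m) | (s i < n)%N]))%N.
Proof.
move=> nm; cbv zeta; apply: (@dim_supported_chain _ _ _
  (fun i : 'I__ => if rev then (2 ^ m - i.+1)%N else i)
  (fun j => (m - r <= popcount j)%N)) => j jn.
by move=> heavy_j; apply: RM_word; rewrite // (leq_trans jn).
Qed.

Lemma dim_RM r m : (r <= m)%N -> \dim (RM r m) = nheavy (m - r) (2 ^ m).
Proof.
move=> rm; apply/eqP; rewrite eqn_leq; apply/andP; split.
  have := dim_shortening_RM_le [set: 'I_(2 ^ m)] rm.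
  rewrite dim_shortening cardsT card_ord.
  apply: leq_trans; apply: dimvS; apply/subvP => c cC; apply/supportedP; split=> // i.
  by rewrite inE.
by apply: leq_trans (dim_supported_RM r false (leqnn _)) (dimvS (capvSl _ _)).
Qed.

End ReedMullerWords.

(** * Widths *)

Lemma far_component_closed (V : finType) (g : rel V) (e : {set V}) (A : {set V}) v :
  v \in A -> (forall x y, delete_edge g e x y -> x \in A -> y \in A) ->
  ~: A \subset far_component g e v.
Proof.
move=> vA closedA; apply/subsetP => x; rewrite !inE; apply: contra => /connectP [p + ->].
by elim: p v vA => //= y p IHp v vA /andP [/closedA/(_ vA) yA]; apply: IHp.
Qed.

(** An end node lacks a neighbour, but the side in question is empty and [f set0 = 0] makes up for
    the missing term. *)
Lemma leq_sum_path_components N (v : 'I_N) (f : {set 'I_N} -> nat) :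
  f set0 = 0 -> (forall A B : {set 'I_N}, A \subset B -> f A <= f B) ->
  f [set x : 'I_N | x < v] + f [set x : 'I_N | v < x]
    <= \sum_(e in incident_edges (@path_rel N) v) f (far_component (@path_rel N) e v).
Proof.
move=> f0 fS.
have inc u : path_rel v u -> [set v; u] \in incident_edges (@path_rel N) v.
  by move=> vu; rewrite !inE eqxx andbT; apply/imsetP; exists (v, u); rewrite ?inE.
have lower (u : 'I_N) : u.+1 = v ->
    f [set x : 'I_N | x < v] <= f (far_component (@path_rel N) [set v; u] v).
  move=> uv; apply: fS; rewrite -[finset _]setCK.
  apply: far_component_closed => [|x y]; first by rewrite !inE ltnn.
  rewrite !inE -!leqNgt => /andP [/orP [] /eqP xy]; first by lia.
  move=> neq_e vx; rewrite leqNgt; apply: contra neq_e => yv.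
  have -> : x = v by apply: val_inj => /=; lia.
  by have -> : y = u by apply: val_inj => /=; lia.
have upper (u : 'I_N) : u = v.+1 :> nat ->
    f [set x : 'I_N | v < x] <= f (far_component (@path_rel N) [set v; u] v).
  move=> uv; apply: fS; rewrite -[finset _]setCK.
  apply: far_component_closed => [|x y]; first by rewrite !inE ltnn.
  rewrite !inE -!leqNgt => /andP [/orP [] /eqP xy]; last by lia.
  move=> neq_e vx; rewrite leqNgt; apply: contra neq_e => yv.
  have -> : x = v by apply: val_inj => /=; lia.
  by have -> : y = u by apply: val_inj => /=; lia.
have first : v = 0 :> nat -> f [set x : 'I_N | x < v] = 0.
  by move=> v0; rewrite -[RHS]f0; congr f; apply/setP => x; rewrite !inE v0.
have last : v.+1 = N -> f [set x : 'I_N | v < x] = 0.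
  move=> vN; rewrite -[RHS]f0; congr f; apply/setP => x.
  by rewrite !inE; have := ltn_ord x; lia.
have [v0|v_gt0] := posnP v.
  rewrite first // add0n; have [vN|vN] := eqVneq v.+1 N; first by rewrite last.
  have v1N : v.+1 < N by have := ltn_ord v; lia.
  pose u := Ordinal v1N.
  rewrite (bigD1 [set v; u]) /=; last by apply: inc; apply/orP; left.
  by rewrite (leq_trans (upper u _)) // leq_addr.
have pN : v.-1 < N by have := ltn_ord v; lia.
pose u' := Ordinal pN; rewrite (bigD1 [set v; u']) /=; last first.
  by apply: inc; apply/orP; right; apply/eqP; exact: prednK.
rewrite leq_add ?lower /= ?prednK //.
have [vN|vN] := eqVneq v.+1 N; first by rewrite last.
have v1N : v.+1 < N by have := ltn_ord v; lia.
pose u := Ordinal v1N; rewrite (bigD1 [set v; u]) /=.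
  by rewrite (leq_trans (upper u _)) // leq_addr.
rewrite inc /=; last by apply/orP; left.
apply/eqP => eq_e.
have : u \in [set v; u'] by rewrite -eq_e !inE eqxx orbT.
rewrite !inE -!val_eqE /=; lia.
Qed.

Lemma node_width_path r m (om : 'I_(2 ^ m) -> 'I_#|'I_(2 ^ m)|) v : r <= m ->
  (forall i, om i = i :> nat) ->
  node_width (RM r m) (@path_rel #|'I_(2 ^ m)|) om v <= profile m (m - r) v.
Proof.
move=> rm om_val; rewrite /node_width dim_RM //; apply: leq_sub2l.
have vn : v < 2 ^ m by rewrite -[X in _ < X]card_ord; exact: ltn_ord.
pose f (A : {set 'I_#|'I_(2 ^ m)|}) := \dim (shortening (RM r m) (om @^-1: A)).
have f_supp A : f A = \dim (supported (RM r m) (om @^-1: A)) by exact: dim_shortening.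
apply: leq_trans (@leq_sum_path_components _ v f _ _); last 2 first.
- apply/eqP; rewrite -leqn0 /f preimset0.
  by apply: leq_trans (dim_shortening_RM_le _ rm) _; rewrite cards0 nheavy0.
- by move=> A B AB; rewrite !f_supp; apply/dimvS/supportedS/preimsetS.
rewrite !f_supp; apply: leq_add.
  apply: leq_trans (dim_supported_RM r false (ltnW vn)) _.
  by apply/dimvS/supportedS/subsetP => i; rewrite !inE om_val.
apply: leq_trans (dim_supported_RM r true (leq_subr v.+1 _)) _.
by apply/dimvS/supportedS/subsetP => i; rewrite !inE om_val /=; have := ltn_ord i; lia.
Qed.

Lemma trelliswidth_RM_le r m : r <= m ->
  trelliswidth (RM r m) <= profile m (m - r) (third m).
Proof.
move=> rm; rewrite /trelliswidth; case: ex_minnP => k _ min_k.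
pose om := cast_ord (esym (card_ord (2 ^ m))).
have om_bij : bijective om.
  by exists (cast_ord (card_ord (2 ^ m))); [exact: cast_ordKV | exact: cast_ordK].
apply: leq_trans (min_k (decomposition_width (RM r m) (@path_rel _) om) _) _.
  by apply/asboolP; exists om.
apply/bigmax_leqP => v _; apply: leq_trans (node_width_path _ rm _) _ => //.
by apply: profile_max; rewrite -[X in _ < X]card_ord; exact: ltn_ord.
Qed.

Lemma leq_treewidth_RM r m : r <= m -> profile m (m - r) (third m) <= treewidth (RM r m).
Proof.
move=> rm; rewrite /treewidth; case: ex_minnP => k /asboolP [V [g [om [tree_g <-]]]] _.
suff [v wide_v] : exists v, profile m (m - r) (third m) <= node_width (RM r m) g om v.
  exact: leq_trans wide_v (leq_bigmax v).
have le_nheavy v :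
    \sum_(e in incident_edges g v) \dim (shortening (RM r m) (om @^-1: far_component g e v))
    <= \sum_(e in incident_edges g v) nheavy (m - r) #|om @^-1: far_component g e v|.
  by apply: leq_sum => e _; exact: dim_shortening_RM_le.
rewrite /node_width dim_RM //; case: (m - r) le_nheavy => [|w] le_nheavy.
  (* The components at a node carrying a coordinate hold at most [2 ^ m - 1] coordinates, so its
     width is at least 1. *)
  have n_gt0 : 0 < 2 ^ m by rewrite expn_gt0.
  exists (om (Ordinal n_gt0)); rewrite profile0 ?third_lt // subn_gt0.
  rewrite (leq_ltn_trans (le_nheavy _)) //; under eq_bigr => e _ do rewrite nheavy0l.
  have := leq_sum_card_preimages tree_g om (om (Ordinal n_gt0)).
  rewrite nheavy0l card_ord.
  apply: leq_trans; rewrite -addn1 leq_add2l card_gt0; apply/set0Pn.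
  by exists (Ordinal n_gt0); rewrite !inE.
have [v parts_v] := @tree_parts m w V g om tree_g.
by exists v; rewrite leq_sub2l // (leq_trans (le_nheavy v)).
Qed.

Lemma treewidth_le_trelliswidth (F : fieldType) (I : finType) (C : {vspace word F I}) :
  0 < #|I| -> treewidth C <= trelliswidth C.
Proof.
move=> I_gt0; rewrite /treewidth /trelliswidth; case: ex_minnP => t _ min_t.
case: ex_minnP => k /asboolP [om [_ <-]] _; apply/min_t/asboolP.
by exists 'I_#|I|, (@path_rel #|I|), om; split=> //; exact: path_rel_tree.
Qed.

Theorem theorem8 (m r : nat) (m_ge1 : 1 <= m) (r_le_m : r <= m) :
  let value :=
    if 2 * r + 1 <= m
    then \sum_(0 <= j < r.+1) 'C(m - 2 * j - 1, r - j)
    else 1 + \sum_(0 <= j < m - r) 'C(m - 2 * j - 1, r - j) in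
  treewidth (RM r m) = value /\ trelliswidth (RM r m) = value.
Proof.
move=> value; have -> : value = profile m (m - r) (third m).
  rewrite /value; case: leqP => rm; first by rewrite profile_third_low.
  by rewrite profile_third_high.
have lower := leq_treewidth_RM r_le_m; have upper := trelliswidth_RM_le r_le_m.
have mid : treewidth (RM r m) <= trelliswidth (RM r m).
  by apply: treewidth_le_trelliswidth; rewrite card_ord expn_gt0.
by split; apply/eqP; rewrite eqn_leq ?lower ?upper ?(leq_trans mid) ?(leq_trans lower).
Qed.
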